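(* Let $G$ be a metrizable SIN group and $\phi:A\to B$ a topological group isomorphism between two closed subgroups $A,B$ of $G$. There exist a metrizable SIN group $H$ containing $G$ as a topological subgroup and an element $t\in H$ with $tat^{-1}=\phi(a)$ for all $a\in A$ if and only if there is a compatible two-sided invariant metric $d$ on $G$ such that $\phi$ is a $d$-isometry.
   Context: A topological group is SIN if every neighborhood of the identity contains a neighborhood $V$ of the identity with $gVg^{-1}=V$ for all $g$. A metrizable group is SIN iff it admits a compatible two-sided invariant metric. A metric is compatible if it induces the topology. *)

(* Defs.v *)
From Stdlib Require Import Reals.
Open Scope R_scope.

Record Topology (X : Type) := {
  is_open : (X -> Prop) -> Prop;
  open_full : is_open (fun _ => True);
  open_inter : forall U V, is_open U -> is_open V -> is_open (fun x => U x /\ V x);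
  open_union : forall F : (X -> Prop) -> Prop,
      (forall U, F U -> is_open U) -> is_open (fun x => exists U, F U /\ U x)
}.
Arguments is_open {X} _ _.

Record TopGroup (G : Type) := {
  gmul : G -> G -> G;
  ginv : G -> G;
  gone : G;
  gmul_assoc : forall x y z, gmul x (gmul y z) = gmul (gmul x y) z;
  gmul_1l : forall x, gmul gone x = x;
  gmul_1r : forall x, gmul x gone = x;
  gmul_Vl : forall x, gmul (ginv x) x = gone;
  gmul_Vr : forall x, gmul x (ginv x) = gone;
  gtop : Topology G;
  gmul_cont : forall W x y, is_open gtop W -> W (gmul x y) ->
     exists U V, is_open gtop U /\ is_open gtop V /\ U x /\ V y /\
       (forall u v, U u -> V v -> W (gmul u v));
  ginv_cont : forall W, is_open gtop W -> is_open gtop (fun x => W (ginv x))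
}.
Arguments gmul {G} _ _ _.
Arguments ginv {G} _ _.
Arguments gone {G} _.
Arguments gtop {G} _.

Definition gopen {G} (T : TopGroup G) (U : G -> Prop) : Prop := is_open (gtop T) U.

Definition gclosed {G} (T : TopGroup G) (C : G -> Prop) : Prop :=
  gopen T (fun x => ~ C x).

Definition nbhd {G} (T : TopGroup G) (x : G) (N : G -> Prop) : Prop :=
  exists U, gopen T U /\ U x /\ (forall y, U y -> N y).

Definition is_metric {X} (d : X -> X -> R) : Prop :=
  (forall x y, 0 <= d x y) /\
  (forall x y, d x y = 0 <-> x = y) /\
  (forall x y, d x y = d y x) /\
  (forall x y z, d x z <= d x y + d y z).

Definition compatible {G} (T : TopGroup G) (d : G -> G -> R) : Prop :=
  forall U : G -> Prop, gopen T U <->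
    (forall x, U x -> exists eps, 0 < eps /\ forall y, d x y < eps -> U y).

Definition metrizable {G} (T : TopGroup G) : Prop :=
  exists d, is_metric d /\ compatible T d.

Definition SIN_group {G} (T : TopGroup G) : Prop :=
  forall N, nbhd T (gone T) N ->
    exists V, nbhd T (gone T) V /\ (forall x, V x -> N x) /\
      (forall g x, V (gmul T (gmul T g x) (ginv T g)) <-> V x).

Definition two_sided_invariant {G} (T : TopGroup G) (d : G -> G -> R) : Prop :=
  forall g x y, d (gmul T g x) (gmul T g y) = d x y /\
                d (gmul T x g) (gmul T y g) = d x y.

Definition subgroup {G} (T : TopGroup G) (A : G -> Prop) : Prop :=
  A (gone T) /\ (forall x y, A x -> A y -> A (gmul T x y)) /\
  (forall x, A x -> A (ginv T x)).

Definition closed_subgroup {G} (T : TopGroup G) (A : G -> Prop) : Prop :=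
  subgroup T A /\ gclosed T A.

(* phi restricted to A is a topological group isomorphism from A onto B
   (A, B carry the subspace topologies). *)
Definition topgrp_iso_on {G} (T : TopGroup G) (A B : G -> Prop) (phi : G -> G) : Prop :=
  (forall a, A a -> B (phi a)) /\
  (forall b, B b -> exists a, A a /\ phi a = b) /\
  (forall a a', A a -> A a' -> phi a = phi a' -> a = a') /\
  (forall a a', A a -> A a' -> phi (gmul T a a') = gmul T (phi a) (phi a')) /\
  (forall U, gopen T U -> exists W, gopen T W /\ forall a, A a -> (U (phi a) <-> W a)) /\
  (* continuity of the inverse B -> A *)
  (forall U, gopen T U -> exists W, gopen T W /\ forall a, A a -> (U a <-> W (phi a))).

Definition topgrp_embedding {G H} (TG : TopGroup G) (TH : TopGroup H) (j : G -> H) : Prop :=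
  (forall x y, j x = j y -> x = y) /\
  (forall x y, j (gmul TG x y) = gmul TH (j x) (j y)) /\
  (forall W, gopen TH W -> gopen TG (fun x => W (j x))) /\
  (forall U, gopen TG U -> exists W, gopen TH W /\ forall x, U x <-> W (j x)).

(* Main.v *)
(** If [H] exists, it carries a two-sided invariant metric (Birkhoff-Kakutani with
    conjugation-invariant neighbourhoods), for which conjugation by [t] is isometric.

    Conversely, let [d] be an invariant metric on [G] making [phi] isometric.  Give a word
    in [G] and the letters [t], [t^-1] the least cost, capped at [1], of turning it into a
    word that nested rewritings [t a t^-1 = phi a], [t^-1 b t = phi^-1 b] bring to the
    identity, where moving a letter from [g] to [h] costs [d g h] (a Graev norm).  This
    cost is subadditive and invariant under inversion and conjugation; since [phi] is
    isometric it does not grow when adjacent inverse letters are cancelled.  Hence it is a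
    two-sided invariant pseudo-metric on words, and [H] is the quotient by distance zero.
    A two-letter word [g^-1 h] contains no stable letter and costs exactly [min (d g h) 1],
    so [G] embeds. *)
Require Import Defs.
From Stdlib Require Import Reals Lra Lia Wf_nat List Bool.
From Stdlib Require Import FunctionalExtensionality ProofIrrelevance IndefiniteDescription.
Import ListNotations.
Open Scope R_scope.

Arguments gmul_assoc {G} _ _ _ _.
Arguments gmul_1l {G} _ _.
Arguments gmul_1r {G} _ _.
Arguments gmul_Vl {G} _ _.
Arguments gmul_Vr {G} _ _.
Arguments gmul_cont {G} _ _ _ _ _ _.
Arguments ginv_cont {G} _ _ _.

(** * Norms and two-sided invariant metrics *)

(** Completeness of the reals supplies suprema, so the infimum is minus the supremum of the negated
    set. *)
Lemma exists_infimum (P : R -> Prop) :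
  (exists c, P c) -> (forall c, P c -> 0 <= c) ->
  exists m, 0 <= m /\ (forall c, P c -> m <= c) /\
    (forall e, 0 < e -> exists c, P c /\ c < m + e).
Proof.
  intros [c0 Hc0] Hpos.
  destruct (completeness (fun r => P (- r))) as [s [Hs Hleast]].
  - exists 0; intros r Hr; apply Hpos in Hr; lra.
  - exists (- c0); now rewrite Ropp_involutive.
  - assert (Hm : forall c, P c -> - s <= c).
    { intros c Hc.
      assert (- c <= s) by (apply Hs; now rewrite Ropp_involutive). lra. }
    exists (- s); repeat split; auto.
    + assert (s <= 0) by (apply Hleast; intros r Hr; apply Hpos in Hr; lra). lra.
    + intros e He. apply Classical_Prop.NNPP; intros Hn.
      assert (s <= s - e); [|lra].
      apply Hleast; intros r Hr.
      destruct (Rle_or_lt r (s - e)) as [|Hlt]; auto.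
      exfalso; apply Hn; exists (- r); split; auto; lra.
Qed.

(** A least cost need not be attained, so a norm is specified by lower bounds and approximation.
    Both the chain norm and the word norm arise this way. *)
Definition is_infimum_of_costs {M} (P : M -> R -> Prop) (N : M -> R) : Prop :=
  forall x, 0 <= N x /\ (forall c, P x c -> N x <= c) /\
    (forall e, 0 < e -> exists c, P x c /\ c < N x + e).

Lemma exists_infimum_of_costs {M} (P : M -> R -> Prop) :
  (forall x, exists c, P x c) -> (forall x c, P x c -> 0 <= c) ->
  exists N, is_infimum_of_costs P N.
Proof.
  intros Hne Hpos.
  apply (functional_choice (fun x m => 0 <= m /\ (forall c, P x c -> m <= c) /\
    (forall e, 0 < e -> exists c, P x c /\ c < m + e))).
  intros x; apply exists_infimum; [apply Hne|apply Hpos].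
Qed.

Lemma infimum_of_costs_le {M} (P : M -> R -> Prop) N x y :
  is_infimum_of_costs P N -> (forall c, P x c -> P y c) -> N y <= N x.
Proof.
  intros HN Hxy; apply le_epsilon; intros e He.
  destruct (HN x) as (_ & _ & Hx); destruct (Hx e He) as (c & Hc & Hlt).
  destruct (HN y) as (_ & Hy & _); apply Hxy, Hy in Hc; lra.
Qed.

Lemma infimum_of_costs_add {M} (P : M -> R -> Prop) N x y z :
  is_infimum_of_costs P N ->
  (forall c c', P x c -> P y c' -> P z (c + c')) -> N z <= N x + N y.
Proof.
  intros HN Hxyz; apply le_epsilon; intros e He.
  destruct (HN x) as (_ & _ & Hx); destruct (Hx (e / 2)) as (c & Hc & Hlt); [lra|].
  destruct (HN y) as (_ & _ & Hy); destruct (Hy (e / 2)) as (c' & Hc' & Hlt'); [lra|].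
  destruct (HN z) as (_ & Hz & _).
  assert (N z <= c + c') by (apply Hz, Hxyz; auto). lra.
Qed.

Section GroupFacts.
Context {G : Type} (T : TopGroup G).
Local Notation "x ** y" := (gmul T x y) (at level 40, left associativity).
Local Notation "x ^-" := (ginv T x) (at level 5).
Local Notation e := (gone T).

Lemma gmul_Vlk x y : x^- ** (x ** y) = y.
Proof. now rewrite gmul_assoc, gmul_Vl, gmul_1l. Qed.

Lemma gmul_Vrk x y : x ** (x^- ** y) = y.
Proof. now rewrite gmul_assoc, gmul_Vr, gmul_1l. Qed.

Lemma ginv_unique x y : x ** y = e -> y = x^-.
Proof. intros H; now rewrite <- (gmul_Vlk x y), H, gmul_1r. Qed.

Lemma ginv_involutive x : x^-^- = x.
Proof. symmetry; apply ginv_unique, gmul_Vl. Qed.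

Lemma ginv_one : e^- = e.
Proof. symmetry; apply ginv_unique, gmul_1l. Qed.

Lemma ginv_mul x y : (x ** y)^- = y^- ** x^-.
Proof.
  symmetry; apply ginv_unique.
  now rewrite <- gmul_assoc, gmul_Vrk, gmul_Vr.
Qed.

Lemma tsi_left d g x y : two_sided_invariant T d -> d (g ** x) (g ** y) = d x y.
Proof. intros H; apply (H g x y). Qed.

Lemma tsi_right d g x y : two_sided_invariant T d -> d (x ** g) (y ** g) = d x y.
Proof. intros H; apply (H g x y). Qed.

(** Balls around [e] are conjugation-invariant: [d e (g ** x ** g^-) = d g (g ** x) = d e x]. *)
Lemma SIN_of_tsi d :
  is_metric d -> compatible T d -> two_sided_invariant T d -> SIN_group T.
Proof.
  intros (Hpos & Hsep & Hsym & Htri) Hcomp Hinv N (U & HU & HUe & HUN).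
  destruct (proj1 (Hcomp U) HU e HUe) as (r & Hr & Hball).
  exists (fun x => d e x < r); split; [|split].
  - exists (fun x => d e x < r); split; [|split; auto].
    + apply Hcomp; intros x Hx; exists (r - d e x); split; [lra|].
      intros y Hy; specialize (Htri e x y); lra.
    + now rewrite (proj2 (Hsep e e) eq_refl).
  - auto.
  - intros g x.
    assert (d e (g ** x ** g^-) = d e x) as ->; [|tauto].
    rewrite <- (tsi_right d g _ _ Hinv), <- gmul_assoc, gmul_Vl, gmul_1r, gmul_1l.
    rewrite <- (gmul_1r T g) at 1. apply tsi_left, Hinv.
Qed.

(** Left invariance is built into [x^- ** y]; right invariance is invariance of [N] under
    conjugation. Inequalities suffice, since each can also be applied to the inverse element. *)
Lemma norm_metric (N : G -> R) (d := fun x y => N (x^- ** y)) :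
  (forall x, 0 <= N x) -> N e = 0 -> (forall x, N x = 0 -> x = e) ->
  (forall x y, N (x ** y) <= N x + N y) -> (forall x, N (x^-) <= N x) ->
  (forall x y, N (y ** x ** y^-) <= N x) ->
  is_metric d /\ two_sided_invariant T d.
Proof.
  intros Hpos Hone Hsep Hmul Hinv Hconj; unfold d; split; [split; [|split; [|split]]|].
  - auto.
  - intros x y; split.
    + intros H%Hsep; rewrite <- (gmul_Vrk x y), H; now rewrite gmul_1r.
    + intros ->; now rewrite gmul_Vl.
  - assert (forall x y, N (x^- ** y) <= N (y^- ** x)).
    { intros x y.
      replace (x^- ** y) with ((y^- ** x)^-); [apply Hinv|].
      now rewrite ginv_mul, ginv_involutive. }
    intros x y; apply Rle_antisym; auto.
  - intros x y z.
    replace (x^- ** z) with (x^- ** y ** (y^- ** z)); [apply Hmul|].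
    now rewrite <- gmul_assoc, gmul_Vrk.
  - intros g x y; split.
    + f_equal; now rewrite ginv_mul, <- gmul_assoc, gmul_Vlk.
    + replace ((x ** g)^- ** (y ** g)) with (g^- ** (x^- ** y) ** g)
        by now rewrite ginv_mul, !gmul_assoc.
      apply Rle_antisym.
      * rewrite <- (ginv_involutive g) at 2; apply Hconj.
      * replace (x^- ** y) with (g ** (g^- ** (x^- ** y) ** g) ** g^-) at 1;
          [apply Hconj|].
        now rewrite <- !gmul_assoc, gmul_Vr, gmul_1r, gmul_Vrk.
Qed.

End GroupFacts.

(** * The Birkhoff-Kakutani theorem for SIN groups *)

Section BirkhoffKakutani.
Context {G : Type} (T : TopGroup G).
Local Notation "x ** y" := (gmul T x y) (at level 40, left associativity).
Local Notation "x ^-" := (ginv T x) (at level 5).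
Local Notation e := (gone T).

Definition invariant_nbhd (V : G -> Prop) : Prop :=
  nbhd T e V /\ (forall x, V x -> V (x^-)) /\ (forall g x, V x -> V (g ** x ** g^-)).

Lemma nbhd_self V : nbhd T e V -> V e.
Proof. intros (U & _ & HUe & HUV); auto. Qed.

Lemma nbhd_inter U V : nbhd T e U -> nbhd T e V -> nbhd T e (fun x => U x /\ V x).
Proof.
  intros (U' & ? & ? & ?) (V' & ? & ? & ?).
  exists (fun x => U' x /\ V' x); split; [now apply open_inter|].
  split; [auto|intros y []; auto].
Qed.

Lemma nbhd_square U : nbhd T e U ->
  exists V, nbhd T e V /\ forall x y, V x -> V y -> U (x ** y).
Proof.
  intros (U' & HU' & HU'e & HU'U).
  destruct (gmul_cont T U' e e HU') as (V & W & HV & HW & HVe & HWe & HVW).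
  { now rewrite gmul_1l. }
  exists (fun x => V x /\ W x); split.
  - apply nbhd_inter; [exists V|exists W]; auto.
  - intros x y [] []; auto.
Qed.

(** Two square roots of [U] accommodate three factors. The SIN property makes the result
    conjugation-invariant, and intersecting with its inverse makes it symmetric. *)
Lemma invariant_nbhd_cube U : SIN_group T -> nbhd T e U ->
  exists V, invariant_nbhd V /\ (forall x, V x -> U x) /\
    forall x y z, V x -> V y -> V z -> U (x ** y ** z).
Proof.
  intros HS HU.
  destruct (nbhd_square U HU) as (V1 & HV1 & HV1U).
  destruct (nbhd_square V1 HV1) as (V2 & HV2 & HV2V1).
  assert (HV21 : forall x, V2 x -> V1 x).
  { intros x Hx; rewrite <- (gmul_1r T x); apply HV2V1, nbhd_self; auto. }
  assert (HV1U' : forall x, V1 x -> U x).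
  { intros x Hx; rewrite <- (gmul_1r T x); apply HV1U, nbhd_self; auto. }
  destruct (HS V2 HV2) as (W & HW & HWV2 & HWconj).
  exists (fun x => W x /\ W (x^-)); split; [split; [|split]|split].
  - apply nbhd_inter; [auto|].
    destruct HW as (O & HO & HOe & HOW).
    exists (fun x => O (x^-)); split; [now apply ginv_cont|].
    split; [now rewrite ginv_one|auto].
  - intros x []; split; [auto|now rewrite ginv_involutive].
  - intros g x [Hx Hx']; split; [now apply HWconj|].
    rewrite !ginv_mul, ginv_involutive, gmul_assoc; now apply HWconj.
  - intros x []; auto.
  - intros x y z [] [] []; apply HV1U; auto.
Qed.

(** * Chains of group elements weighted by powers of one half *)

Fixpoint chain_prod (l : list (G * nat)) : G :=
  match l with [] => e | (x, _) :: l' => x ** chain_prod l' end.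

(** In a pair [(x, n)], the factor [x] will come from the [n]-th neighbourhood, at price
    [(/ 2) ^ n]. *)
Fixpoint chain_sum (l : list (G * nat)) : R :=
  match l with [] => 0 | (_, n) :: l' => (/ 2) ^ n + chain_sum l' end.

Lemma half_pow_pos n : 0 < (/ 2) ^ n.
Proof. apply pow_lt; lra. Qed.

Lemma half_pow_lt m n : (/ 2) ^ m < (/ 2) ^ n -> (n < m)%nat.
Proof.
  intros H; destruct (Nat.le_gt_cases m n) as [Hle|]; auto.
  exfalso; replace n with (m + (n - m))%nat in H by lia.
  rewrite pow_add in H.
  assert ((/ 2) ^ (n - m) <= 1 ^ (n - m)) by (apply pow_incr; lra).
  rewrite pow1 in *; pose proof (half_pow_pos m); nra.
Qed.

Lemma chain_prod_app l l' : chain_prod (l ++ l') = chain_prod l ** chain_prod l'.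
Proof.
  induction l as [|[x n] l IH]; simpl; [now rewrite gmul_1l|].
  now rewrite IH, gmul_assoc.
Qed.

Lemma chain_sum_app l l' : chain_sum (l ++ l') = chain_sum l + chain_sum l'.
Proof. induction l as [|[x n] l IH]; simpl; [|rewrite IH]; lra. Qed.

Lemma chain_sum_nonneg l : 0 <= chain_sum l.
Proof.
  induction l as [|[x n] l IH]; simpl; [lra|].
  pose proof (half_pow_pos n); lra.
Qed.

Lemma chain_split l r : 0 <= r -> r < chain_sum l ->
  exists l1 x n l2, l = l1 ++ (x, n) :: l2 /\
    chain_sum l1 <= r < chain_sum l1 + (/ 2) ^ n.
Proof.
  revert r; induction l as [|[x n] l IH]; simpl; intros r Hr Hlt; [lra|].
  destruct (Rlt_or_le r ((/ 2) ^ n)).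
  - exists [], x, n, l; simpl; split; [reflexivity|lra].
  - destruct (IH (r - (/ 2) ^ n)) as (l1 & y & m & l2 & -> & Hle); [lra|lra|].
    exists ((x, n) :: l1), y, m, l2; simpl; split; [reflexivity|lra].
Qed.

Section Chains.
Context (V : nat -> G -> Prop).
Context (V_total : forall x, V 0%nat x).
Context (V_invariant : forall n, invariant_nbhd (V n)).
Context (V_cube : forall n x y z, V (S n) x -> V (S n) y -> V (S n) z -> V n (x ** y ** z)).

Lemma V_one n : V n e.
Proof. apply nbhd_self, V_invariant. Qed.

Lemma V_antitone m n x : (m <= n)%nat -> V n x -> V m x.
Proof.
  induction 1 as [|n Hle IH]; intros Hx; auto.
  apply IH; rewrite <- (gmul_1r T x), <- (gmul_1l T x).
  apply V_cube; auto using V_one.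
Qed.

Definition is_chain (l : list (G * nat)) : Prop := Forall (fun p => V (snd p) (fst p)) l.

(* Split a chain at the entry where the partial sums cross half of the total:
   both halves and the middle entry then lie in [V (S n)]. *)
Lemma chain_prod_small l n : is_chain l -> chain_sum l < (/ 2) ^ n -> V n (chain_prod l).
Proof.
  remember (length l) as k eqn:Hk; revert l n Hk.
  induction k as [k IH] using lt_wf_ind; intros l n -> Hl Hlt.
  (* Splitting at half the total requires a positive total; weights being positive, a zero total
     means the empty chain. *)
  destruct (Req_dec (chain_sum l) 0) as [H0|H0].
  - destruct l as [|[x m] l]; simpl in *; [apply V_one|].
    pose proof (half_pow_pos m); pose proof (chain_sum_nonneg l); lra.
  - pose proof (chain_sum_nonneg l).
    destruct (chain_split l (chain_sum l / 2)) as (l1 & x & m & l2 & -> & Hsum); [lra|lra|].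
    apply Forall_app in Hl as [Hl1 Hl2]; inversion Hl2 as [|? ? Hx Hl2']; subst; simpl in Hx.
    rewrite chain_sum_app in *; simpl in *.
    pose proof (chain_sum_nonneg l1); pose proof (chain_sum_nonneg l2).
    assert (Hm : (n < m)%nat) by (apply half_pow_lt; lra).
    rewrite chain_prod_app; simpl; rewrite gmul_assoc; apply V_cube.
    + apply (IH (length l1)); auto; [rewrite length_app; simpl; lia|simpl; lra].
    + now apply (V_antitone _ m).
    + apply (IH (length l2)); auto; [rewrite length_app; simpl; lia|simpl; lra].
Qed.

Definition chain_cost (x : G) (c : R) : Prop :=
  exists l, is_chain l /\ chain_prod l = x /\ chain_sum l <= c.

Lemma chain_cost_exists x : exists c, chain_cost x c.
Proof.
  (* [V 0] is the whole group, so a single entry of weight [(/ 2) ^ 0 = 1] always works. *)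
  exists 1, [(x, 0%nat)]; split; [|simpl; split; [apply gmul_1r|lra]].
  repeat constructor; apply V_total.
Qed.

Lemma chain_cost_nonneg x c : chain_cost x c -> 0 <= c.
Proof. intros (l & _ & _ & Hle); pose proof (chain_sum_nonneg l); lra. Qed.

Lemma chain_cost_mul x y c c' :
  chain_cost x c -> chain_cost y c' -> chain_cost (x ** y) (c + c').
Proof.
  intros (l & Hl & <- & Hc) (l' & Hl' & <- & Hc').
  exists (l ++ l'); split; [now apply Forall_app|].
  split; [apply chain_prod_app|rewrite chain_sum_app; lra].
Qed.

(** Reverse the chain and invert each entry; symmetry of the neighbourhoods keeps the indices. *)
Lemma chain_cost_inv x c : chain_cost x c -> chain_cost (x^-) c.
Proof.
  intros (l & Hl & <- & Hc).
  assert (exists l', is_chain l' /\ chain_prod l' = (chain_prod l)^- /\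
    chain_sum l' = chain_sum l) as (l' & ? & ? & ?).
  2: { exists l'; repeat split; auto; lra. }
  clear c Hc; induction Hl as [|[x n] l Hx Hl (l' & Hl' & Hp & Hs)].
  - exists []; simpl; now rewrite ginv_one; repeat constructor.
  - exists (l' ++ [(x^-, n)]); split; [|split].
    + apply Forall_app; split; auto; repeat constructor; simpl.
      now apply V_invariant.
    + rewrite chain_prod_app, Hp; simpl; now rewrite gmul_1r, ginv_mul.
    + rewrite chain_sum_app, Hs; simpl; lra.
Qed.

Lemma chain_cost_conj x g c : chain_cost x c -> chain_cost (g ** x ** g^-) c.
Proof.
  intros (l & Hl & <- & Hc).
  exists (map (fun p => (g ** fst p ** g^-, snd p)) l); split; [|split].
  - apply Forall_map; eapply Forall_impl; [|exact Hl].
    intros [x n] Hx; now apply V_invariant.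
  - clear; induction l as [|[x n] l IH]; simpl; [now rewrite gmul_1r, gmul_Vr|].
    rewrite IH; now rewrite <- !gmul_assoc, gmul_Vlk.
  - enough (chain_sum (map (fun p => (g ** fst p ** g^-, snd p)) l) = chain_sum l) as -> by auto.
    clear; induction l as [|[x n] l IH]; simpl; congruence.
Qed.

End Chains.

(** Each neighbourhood is chosen from its predecessor and inside a [delta]-ball of vanishing radius.
    The subtype carries invariance through the recursion, so that a choice function can be
    iterated. *)
Lemma exists_invariant_sequence delta :
  is_metric delta -> compatible T delta -> SIN_group T ->
  exists V : nat -> G -> Prop, (forall x, V 0%nat x) /\
    (forall n, invariant_nbhd (V n)) /\
    (forall n x y z, V (S n) x -> V (S n) y -> V (S n) z -> V n (x ** y ** z)) /\
    (forall n x, V (S n) x -> delta e x < / INR (S n)).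
Proof.
  intros (Hpos & Hsep & Hsym & Htri) Hcomp HS.
  assert (Hstep : forall p : nat * {V | invariant_nbhd V}, exists W : {V | invariant_nbhd V},
    (forall x y z, proj1_sig W x -> proj1_sig W y -> proj1_sig W z ->
       proj1_sig (snd p) (x ** y ** z)) /\
    (forall x, proj1_sig W x -> delta e x < / INR (S (fst p)))).
  { intros (n & V & HV).
    assert (Hn : 0 < / INR (S n)) by (apply Rinv_0_lt_compat, lt_0_INR; lia).
    destruct (invariant_nbhd_cube (fun x => V x /\ delta e x < / INR (S n)))
      as (W & HW & HWsub & HW3); auto.
    - apply nbhd_inter; [apply HV|].
      exists (fun x => delta e x < / INR (S n)); split; [|split; auto].
      + apply Hcomp; intros x Hx; exists (/ INR (S n) - delta e x); split; [lra|].
        intros y Hy; specialize (Htri e x y); lra.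
      + now rewrite (proj2 (Hsep e e) eq_refl).
    - exists (exist _ W HW); simpl; split.
      + intros x y z Hx Hy Hz; now apply HW3.
      + intros x Hx; now apply HWsub. }
  apply functional_choice in Hstep as [step Hstep].
  assert (H0 : invariant_nbhd (fun _ => True)).
  { split; [|auto]; exists (fun _ => True); split; [apply open_full|auto]. }
  exists (fun n => proj1_sig
    (nat_rect (fun _ => {V | invariant_nbhd V}) (exist _ _ H0) (fun n W => step (n, W)) n)).
  split; [|split; [|split]].
  - simpl; auto.
  - intros n; apply proj2_sig.
  - intros n; apply (Hstep (n, _)).
  - intros n; apply (Hstep (n, _)).
Qed.

(** The infimum [N] of chain sums is a conjugation-invariant norm, and the sets [V n] interleave
    with its balls. As they shrink to [e] for [delta], [N] separates points and induces the
    topology. *)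
Theorem SIN_metrizable_tsi : metrizable T -> SIN_group T ->
  exists d, is_metric d /\ compatible T d /\ two_sided_invariant T d.
Proof.
  intros (delta & Hm & Hcomp) HS.
  destruct (exists_invariant_sequence delta Hm Hcomp HS)
    as (V & V_total & V_inv & V_cube & V_small).
  destruct Hm as (Hpos & Hsep & Hsym & Htri).
  destruct (exists_infimum_of_costs (chain_cost V)) as [N HN].
  { apply chain_cost_exists; auto. }
  { apply chain_cost_nonneg. }
  assert (Hlow : forall n x, N x < (/ 2) ^ n -> V n x).
  { intros n x Hx; destruct (HN x) as (_ & _ & Hc).
    destruct (Hc ((/ 2) ^ n - N x)) as (c & (l & Hl & <- & Hs) & Hlt); [lra|].
    apply chain_prod_small; auto; lra. }
  assert (Hup : forall n x, V n x -> N x <= (/ 2) ^ n).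
  { intros n x Hx; apply HN; exists [(x, n)]; split; [repeat constructor; auto|].
    simpl; split; [apply gmul_1r|lra]. }
  assert (Hball : forall r, 0 < r -> exists n, forall x, V n x -> delta e x < r).
  { intros r Hr; destruct (archimed_cor1 r Hr) as (n & Hn & Hn0).
    exists n; intros x Hx; destruct n as [|n]; [lia|].
    apply V_small in Hx; lra. }
  exists (fun x y => N (x^- ** y)).
  destruct (norm_metric T N) as [HNm HNi].
  - apply HN.
  - apply Rle_antisym; [|apply HN].
    apply HN; exists []; split; [constructor|simpl; split; [auto|lra]].
  - intros x Hx; symmetry; apply Hsep, Rle_antisym; [|auto].
    apply le_epsilon; intros r Hr; destruct (Hball r Hr) as [n Hn].
    assert (delta e x < r); [|lra].
    apply Hn, Hlow; rewrite Hx; apply half_pow_pos.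
  - intros x y; eapply infimum_of_costs_add; [exact HN|apply chain_cost_mul].
  - intros x; eapply infimum_of_costs_le; [exact HN|apply chain_cost_inv; auto].
  - intros x y; eapply infimum_of_costs_le; [exact HN|].
    intros c; apply chain_cost_conj; auto.
  - split; [exact HNm|split; [|exact HNi]].
    intros U; split.
    (* [delta] need not be invariant, so neighbourhoods are carried between [x] and [e] by
       continuity of multiplication. *)
    + intros HU x Hx.
      destruct (gmul_cont T U x e HU) as (W1 & W2 & _ & HW2 & Hx1 & HW2e & HW).
      { now rewrite gmul_1r. }
      destruct (proj1 (Hcomp W2) HW2 e HW2e) as (r & Hr & HrW).
      destruct (Hball r Hr) as [n Hn].
      exists ((/ 2) ^ n); split; [apply half_pow_pos|].
      intros y Hy%Hlow%Hn; rewrite <- (gmul_Vrk T x y); auto.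
    + intros HU; apply Hcomp; intros x Hx.
      destruct (HU x Hx) as (r & Hr & HrU).
      destruct (pow_lt_1_zero (/ 2)) with (y := r) as [n Hn]; [|auto|].
      { rewrite Rabs_pos_eq; lra. }
      specialize (Hn n (le_n n)); rewrite Rabs_pos_eq in Hn
        by (pose proof (half_pow_pos n); lra).
      destruct (V_inv n) as ((O & HO & HOe & HOV) & _).
      destruct (gmul_cont T O (x^-) x HO) as (W1 & W2 & _ & HW2 & Hx1 & HW2x & HW).
      { now rewrite gmul_Vl. }
      destruct (proj1 (Hcomp W2) HW2 x HW2x) as (s & Hs & HsW).
      exists s; split; auto; intros y Hy; apply HrU.
      apply Rle_lt_trans with ((/ 2) ^ n); auto.
Qed.

End BirkhoffKakutani.

(** * The topological group of a two-sided invariant metric *)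

Section MetricGroup.
Context {H : Type} (mul : H -> H -> H) (inv : H -> H) (one : H) (d : H -> H -> R).
Context (mul_assoc : forall x y z, mul x (mul y z) = mul (mul x y) z).
Context (mul_1l : forall x, mul one x = x) (mul_1r : forall x, mul x one = x).
Context (mul_Vl : forall x, mul (inv x) x = one) (mul_Vr : forall x, mul x (inv x) = one).
Context (d_metric : is_metric d).
Context (d_left : forall g x y, d (mul g x) (mul g y) <= d x y).
Context (d_right : forall g x y, d (mul x g) (mul y g) <= d x y).

Definition metric_topology : Topology H.
Proof.
  refine (Build_Topology H
    (fun U => forall x, U x -> exists r, 0 < r /\ forall y, d x y < r -> U y) _ _ _).
  - intros x _; exists 1; split; [lra|auto].
  - intros U V HU HV x [Ux Vx].
    destruct (HU x Ux) as (r & Hr & HrU), (HV x Vx) as (s & Hs & HsV).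
    exists (Rmin r s); split; [now apply Rmin_glb_lt|].
    intros y Hy; split; [apply HrU|apply HsV];
      (eapply Rlt_le_trans; [exact Hy|]); [apply Rmin_l|apply Rmin_r].
  - intros F HF x (U & HU & Ux).
    destruct (HF U HU x Ux) as (r & Hr & HrU); exists r; split; eauto.
Defined.

Lemma metric_ball_open x r : is_open metric_topology (fun y => d x y < r).
Proof.
  intros y Hy; exists (r - d x y); split; [lra|].
  intros z Hz; destruct d_metric as (_ & _ & _ & Htri).
  specialize (Htri x y z); lra.
Qed.

Definition metric_group : TopGroup H.
Proof.
  refine (Build_TopGroup H mul inv one mul_assoc mul_1l mul_1r mul_Vl mul_Vr
            metric_topology _ _); destruct d_metric as (_ & Hsep & Hsym & Htri).
  - intros W x y HW Wxy; destruct (HW _ Wxy) as (r & Hr & HrW).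
    exists (fun u => d x u < r / 2), (fun v => d y v < r / 2).
    rewrite (proj2 (Hsep x x) eq_refl), (proj2 (Hsep y y) eq_refl).
    repeat split; try lra; try apply metric_ball_open.
    intros u v Hu Hv; apply HrW.
    pose proof (Htri (mul x y) (mul u y) (mul u v)).
    pose proof (d_right y x u); pose proof (d_left u y v); lra.
  - intros W HW x Wx; destruct (HW _ Wx) as (r & Hr & HrW).
    exists r; split; auto; intros y Hy; apply HrW.
    (* Multiplying by [inv x] on the left and [inv y] on the right turns the pair [y], [x] into
       [inv x], [inv y]; hence inversion does not increase distances. *)
    pose proof (d_left (inv x) y x) as H1.
    pose proof (d_right (inv y) (mul (inv x) y) (mul (inv x) x)) as H2.
    rewrite <- mul_assoc, mul_Vr, mul_1r, mul_Vl, mul_1l in H2.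
    rewrite (Hsym y x) in H1; rewrite mul_Vl in H1; lra.
Defined.

Lemma metric_group_tsi : two_sided_invariant metric_group d.
Proof.
  intros g x y; simpl; split; apply Rle_antisym; auto.
  - rewrite <- (mul_1l x), <- (mul_1l y) at 1.
    rewrite <- (mul_Vl g), <- !mul_assoc; auto.
  - rewrite <- (mul_1r x), <- (mul_1r y) at 1.
    rewrite <- (mul_Vr g), !mul_assoc; auto.
Qed.

End MetricGroup.

(** * Quotient of a monoid with an invariant pseudo-metric *)

Section QuotientGroup.
Context {M : Type} (op : M -> M -> M) (inv : M -> M) (one : M) (rho : M -> M -> R).
Context (op_assoc : forall x y z, op x (op y z) = op (op x y) z).
Context (op_1l : forall x, op one x = x) (op_1r : forall x, op x one = x).
Context (rho_nonneg : forall x y, 0 <= rho x y) (rho_refl : forall x, rho x x = 0).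
Context (rho_sym : forall x y, rho x y = rho y x).
Context (rho_tri : forall x y z, rho x z <= rho x y + rho y z).
Context (rho_left : forall g x y, rho (op g x) (op g y) <= rho x y).
Context (rho_right : forall g x y, rho (op x g) (op y g) <= rho x y).
Context (rho_Vl : forall x, rho (op (inv x) x) one = 0).
Context (rho_Vr : forall x, rho (op x (inv x)) one = 0).

(* The class of [u] at distance zero is represented by the function [rho u]. *)
Definition quot : Type := {f : M -> R | exists u, f = rho u}.

Definition quot_class (u : M) : quot := exist _ (rho u) (ex_intro _ u eq_refl).

Definition quot_rep (h : quot) : M :=
  proj1_sig (constructive_indefinite_description _ (proj2_sig h)).

Definition quot_dist (h k : quot) : R := rho (quot_rep h) (quot_rep k).

Lemma quot_class_rep h : quot_class (quot_rep h) = h.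
Proof.
  destruct h as [f Hf]; unfold quot_rep, quot_class; simpl.
  destruct (constructive_indefinite_description _ Hf) as [u Hu]; simpl.
  now apply subset_eq_compat.
Qed.

Lemma rho_zero_eq u v : rho u v = 0 -> rho u = rho v.
Proof.
  intros Huv; apply functional_extensionality; intros z.
  pose proof (rho_tri u v z); pose proof (rho_tri v u z).
  rewrite (rho_sym v u) in *; lra.
Qed.

Lemma quot_class_eq u v : rho u v = 0 <-> quot_class u = quot_class v.
Proof.
  split.
  - intros Huv; apply subset_eq_compat, rho_zero_eq, Huv.
  - intros E%(f_equal (@proj1_sig _ _)); simpl in E; rewrite E; apply rho_refl.
Qed.

Lemma quot_dist_class u v : quot_dist (quot_class u) (quot_class v) = rho u v.
Proof.
  unfold quot_dist.
  pose proof (proj2 (quot_class_eq _ _) (quot_class_rep (quot_class u))) as Hu%rho_zero_eq.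
  pose proof (proj2 (quot_class_eq _ _) (quot_class_rep (quot_class v))) as Hv%rho_zero_eq.
  now rewrite Hu, rho_sym, Hv, rho_sym.
Qed.

Lemma quot_class_surj h : exists u, h = quot_class u.
Proof. exists (quot_rep h); now rewrite quot_class_rep. Qed.

Definition quot_mul (h k : quot) : quot := quot_class (op (quot_rep h) (quot_rep k)).
Definition quot_inv (h : quot) : quot := quot_class (inv (quot_rep h)).

Lemma rho_rep u : rho (quot_rep (quot_class u)) u = 0.
Proof. apply quot_class_eq, quot_class_rep. Qed.

Lemma rho_op u u' v v' : rho (op u v) (op u' v') <= rho u u' + rho v v'.
Proof.
  eapply Rle_trans; [apply (rho_tri _ (op u' v))|]; auto using Rplus_le_compat.
Qed.

(** The two-sided translation argument for inversion in a metric group, with triangle inequalities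
    replacing the cancellations that hold only up to distance zero. *)
Lemma rho_inv x y : rho (inv x) (inv y) <= rho x y.
Proof.
  pose proof (rho_tri (inv x) (op (inv x) (op y (inv y))) (inv y)) as H0.
  pose proof (rho_left (inv x) one (op y (inv y))) as H1.
  rewrite op_1r, rho_sym, (rho_sym one), rho_Vr, rho_sym in H1.
  pose proof (rho_right (inv y) (op (inv x) y) one) as H2.
  rewrite op_1l, <- op_assoc in H2.
  pose proof (rho_tri (op (inv x) y) (op (inv x) x) one) as H3.
  rewrite rho_Vl in H3.
  pose proof (rho_left (inv x) y x) as H4; rewrite (rho_sym y) in H4; lra.
Qed.

Lemma quot_mul_class u v : quot_mul (quot_class u) (quot_class v) = quot_class (op u v).
Proof.
  apply quot_class_eq, Rle_antisym; auto.
  eapply Rle_trans; [apply rho_op|]; rewrite !rho_rep; lra.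
Qed.

Lemma quot_inv_class u : quot_inv (quot_class u) = quot_class (inv u).
Proof.
  apply quot_class_eq, Rle_antisym; auto.
  rewrite <- (rho_rep u); apply rho_inv.
Qed.

(** [M] is only a monoid, such as words under concatenation; [inv] becomes a genuine inverse once
    points at distance zero are identified. *)
Theorem exists_metric_quotient :
  exists (H : Type) (T : TopGroup H) (cl : M -> H) (d : H -> H -> R),
    is_metric d /\ compatible T d /\ two_sided_invariant T d /\
    (forall u v, d (cl u) (cl v) = rho u v) /\
    (forall u v, cl (op u v) = gmul T (cl u) (cl v)) /\
    (forall u, cl (inv u) = ginv T (cl u)).
Proof.
  assert (Hm : is_metric quot_dist).
  { split; [|split; [|split]].
    - intros h k; apply rho_nonneg.
    - intros h k; destruct (quot_class_surj h) as [u ->], (quot_class_surj k) as [v ->].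
      rewrite quot_dist_class; apply quot_class_eq.
    - intros h k; apply rho_sym.
    - intros h k l; apply rho_tri. }
  unshelve eexists quot, (metric_group quot_mul quot_inv (quot_class one) quot_dist
    _ _ _ _ _ Hm _ _), quot_class, quot_dist.
  - intros h k l; destruct (quot_class_surj h) as [u ->], (quot_class_surj k) as [v ->],
      (quot_class_surj l) as [w ->]; now rewrite !quot_mul_class, op_assoc.
  - intros h; destruct (quot_class_surj h) as [u ->]; now rewrite quot_mul_class, op_1l.
  - intros h; destruct (quot_class_surj h) as [u ->]; now rewrite quot_mul_class, op_1r.
  - intros h; destruct (quot_class_surj h) as [u ->].
    rewrite quot_inv_class, quot_mul_class; now apply quot_class_eq.
  - intros h; destruct (quot_class_surj h) as [u ->].
    rewrite quot_inv_class, quot_mul_class; now apply quot_class_eq.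
  - intros g h k; destruct (quot_class_surj g) as [u ->], (quot_class_surj h) as [v ->],
      (quot_class_surj k) as [w ->]; rewrite !quot_mul_class, !quot_dist_class; auto.
  - intros g h k; destruct (quot_class_surj g) as [u ->], (quot_class_surj h) as [v ->],
      (quot_class_surj k) as [w ->]; rewrite !quot_mul_class, !quot_dist_class; auto.
  - split; [exact Hm|]; split; [intros U; reflexivity|]; split; [apply metric_group_tsi|].
    split; [apply quot_dist_class|].
    split; intros; simpl; [now rewrite quot_mul_class|now rewrite quot_inv_class].
Qed.

End QuotientGroup.

(** * The metric HNN extension *)

Section HNN.
Context {G : Type} (T : TopGroup G) (d : G -> G -> R).
Context (d_metric : is_metric d) (d_tsi : two_sided_invariant T d).
(** The boolean treats [phi] and its inverse symmetrically: in the application [D true] is [A],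
    [D false] is [B], and [F false] inverts [F true]. *)
Context (D : bool -> G -> Prop) (F : bool -> G -> G).
Context (D_subgroup : forall s, subgroup T (D s)).
Context (F_maps : forall s a, D s a -> D (negb s) (F s a)).
Context (F_mul : forall s a b, D s a -> D s b -> F s (gmul T a b) = gmul T (F s a) (F s b)).
Context (F_cancel : forall s a, D s a -> F (negb s) (F s a) = a).
Context (F_isometry : forall s a b, D s a -> D s b -> d (F s a) (F s b) = d a b).

Local Notation "x ** y" := (gmul T x y) (at level 40, left associativity).
Local Notation "x ^-" := (ginv T x) (at level 5).
Local Notation e := (gone T).

Lemma D_one s : D s e.
Proof. apply D_subgroup. Qed.

Lemma D_mul s a b : D s a -> D s b -> D s (a ** b).
Proof. apply D_subgroup. Qed.

Lemma D_inv s a : D s a -> D s (a^-).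
Proof. apply D_subgroup. Qed.

Lemma F_negb_maps s b : D (negb s) b -> D s (F (negb s) b).
Proof. intros Hb; rewrite <- (negb_involutive s) at 1; auto. Qed.

Lemma F_negb_cancel s b : D (negb s) b -> F s (F (negb s) b) = b.
Proof. intros Hb; rewrite <- (negb_involutive s) at 1; auto. Qed.

Lemma F_one s : F s e = e.
Proof.
  assert (F s e ** F s e = F s e).
  { rewrite <- F_mul by apply D_one; now rewrite gmul_1l. }
  rewrite <- (gmul_Vlk T (F s e) (F s e)) at 1; rewrite H; apply gmul_Vl.
Qed.

Lemma F_dist_one s a : D s a -> d (F s a) e = d a e.
Proof. intros Ha; rewrite <- (F_one s) at 1; apply F_isometry; auto using D_one. Qed.

Lemma D_cancel_l s a b : D s a -> D s (a ** b) -> D s b.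
Proof. intros Ha Hab; rewrite <- (gmul_Vlk T a b); auto using D_mul, D_inv. Qed.

Lemma D_cancel_r s a b : D s b -> D s (a ** b) -> D s a.
Proof.
  intros Hb Hab; rewrite <- (gmul_1r T a), <- (gmul_Vr T b), gmul_assoc.
  auto using D_mul, D_inv.
Qed.

(* [St true] is the stable letter and [St false] its formal inverse. *)
Inductive letter : Type := El (g : G) | St (s : bool).

Definition letter_inv (x : letter) : letter :=
  match x with El g => El (g^-) | St s => St (negb s) end.

Definition word_inv (w : list letter) : list letter := rev (map letter_inv w).

Lemma letter_inv_involutive x : letter_inv (letter_inv x) = x.
Proof. destruct x; simpl; [now rewrite ginv_involutive|now rewrite negb_involutive]. Qed.

Lemma word_inv_app u v : word_inv (u ++ v) = word_inv v ++ word_inv u.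
Proof. unfold word_inv; now rewrite map_app, rev_app_distr. Qed.

Lemma word_inv_cons x w : word_inv (x :: w) = word_inv w ++ [letter_inv x].
Proof. reflexivity. Qed.

Lemma word_inv_involutive w : word_inv (word_inv w) = w.
Proof.
  induction w as [|x w IH]; auto.
  now rewrite word_inv_cons, word_inv_app, IH; simpl; rewrite letter_inv_involutive.
Qed.

(* [eval w g c]: after moving group letters of [w] by a total distance at most [c],
   the stable letters can be removed by nested rewritings
   [t a t^-1 = phi a] and [t^-1 b t = phi^-1 b], leaving [g]. *)
Inductive eval : list letter -> G -> R -> Prop :=
| eval_nil g c : d g e <= c -> eval [] g c
| eval_el h w g c : eval w g c -> eval (El h :: w) (h ** g) c
| eval_st s u a c1 v g c2 : eval u a c1 -> D s a -> eval v g c2 ->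
    eval (St s :: u ++ St (negb s) :: v) (F s a ** g) (c1 + c2).

(** By left invariance a change of value is pushed past all letters to the final [eval_nil], where
    it is paid. *)
Lemma eval_weaken w g g' c c' : eval w g c -> d g g' + c <= c' -> eval w g' c'.
Proof.
  destruct d_metric as (Hpos & Hsep & Hsym & Htri).
  intros Hw; revert g' c'; induction Hw as [g c Hc|h w g c Hw IH|s u a c1 v g c2 Hu _ Ha Hv IH];
    intros g' c' Hle.
  - constructor; specialize (Htri g' g e); rewrite (Hsym g' g) in Htri; lra.
  - rewrite <- (gmul_Vrk T h g'); constructor; apply IH.
    now rewrite <- (tsi_left T d h), gmul_Vrk.
  - rewrite <- (gmul_Vrk T (F s a) g').
    replace c' with (c1 + (c' - c1)) by ring; constructor; auto; apply IH.
    rewrite <- (tsi_left T d (F s a)), gmul_Vrk by auto; lra.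
Qed.

(** The error at the end of [u] is absorbed into the value of [v], at equal cost by right
    invariance. *)
Lemma eval_app u g c v g' c' : eval u g c -> eval v g' c' -> eval (u ++ v) (g ** g') (c + c').
Proof.
  intros Hu Hv; induction Hu as [g c Hc|h w g c Hw IH|s u a c1 v' g c2 Hu _ Ha Hv' IH]; simpl.
  - eapply eval_weaken; [exact Hv|].
    destruct d_metric as (_ & _ & Hsym & _).
    rewrite <- (gmul_1l T g') at 1; rewrite tsi_right, Hsym by auto; lra.
  - rewrite <- gmul_assoc; now constructor.
  - rewrite <- app_assoc, <- gmul_assoc, Rplus_assoc; simpl; now constructor.
Qed.

Lemma eval_el_inv h w g c : eval (El h :: w) g c -> exists k, g = h ** k /\ eval w k c.
Proof. inversion 1; subst; eauto. Qed.

Lemma eval_st_inv s w g c : eval (St s :: w) g c ->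
  exists p q b k c1 c2, w = p ++ St (negb s) :: q /\ eval p b c1 /\ D s b /\
    eval q k c2 /\ g = F s b ** k /\ c = c1 + c2.
Proof. inversion 1; subst; repeat eexists; eauto. Qed.

(** The mirror image of [eval_st_inv]. Since [eval] parses from the left, the partner of a final
    stable letter must be found by induction. *)
Lemma eval_st_inv_last s w g c : eval (w ++ [St (negb s)]) g c ->
  exists p q k b c1 c2, w = p ++ St s :: q /\ eval p k c1 /\ eval q b c2 /\ D s b /\
    g = k ** F s b /\ c1 + c2 = c.
Proof.
  intros Hw; remember (w ++ [St (negb s)]) as z eqn:Hz; revert w Hz.
  induction Hw as [g c Hc|h z g c Hz IH|s' u a c1 v g c2 Hu _ Ha Hv IH]; intros w Ew.
  - now apply app_cons_not_nil in Ew.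
  - destruct w as [|x w]; [discriminate|]; injection Ew as <- Ew.
    destruct (IH w Ew) as (p & q & k & b & c1 & c2 & -> & Hp & Hq & Hb & -> & Hc).
    exists (El h :: p), q, (h ** k), b, c1, c2; repeat split; auto;
      [now constructor|now rewrite gmul_assoc].
  - destruct v as [|x v _] using rev_ind.
    + change (St s' :: u ++ [St (negb s')]) with ((St s' :: u) ++ [St (negb s')]) in Ew.
      apply app_inj_tail in Ew as [<- Es]; injection Es as Es.
      apply (f_equal negb) in Es; rewrite !negb_involutive in Es; subst s'.
      (* Nothing follows the closing letter, so [g] is within [c2] of [e]; conjugation moves it to
         the left of [F s a] at the same cost. *)
      exists [], u, (F s a ** g ** (F s a)^-), a, c2, c1; repeat split; auto; [| |lra].
      * inversion Hv as [g' c' Hg| |]; subst; constructor.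
        rewrite <- (tsi_right T d (F s a)), <- gmul_assoc, gmul_Vl, gmul_1l, gmul_1r by auto.
        rewrite <- (gmul_1r T (F s a)) at 2; now rewrite tsi_left.
      * now rewrite <- gmul_assoc, gmul_Vl, gmul_1r.
    + change (St s' :: u ++ St (negb s') :: v ++ [x])
        with ((St s' :: u) ++ (St (negb s') :: v) ++ [x]) in Ew.
      rewrite app_assoc in Ew; apply app_inj_tail in Ew as [<- ->].
      destruct (IH v eq_refl) as (p & q & k & b & c3 & c4 & -> & Hp & Hq & Hb & -> & <-).
      exists (St s' :: u ++ St (negb s') :: p), q, (F s' a ** k), b, (c1 + c3), c4.
      repeat split; auto; [|now constructor|now rewrite gmul_assoc|lra].
      simpl; now rewrite <- app_assoc.
Qed.

(** The cases locate the marked [z] relative to the adjacent pair: after it, at its second letter,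
    at its first letter, or before it. *)
Lemma app_pair_eq_app_cons {X} (u v u1 v1 : list X) x y z :
  u ++ x :: y :: v = u1 ++ z :: v1 ->
  (exists p, u1 = u ++ x :: y :: p /\ v = p ++ z :: v1) \/
  (u1 = u ++ [x] /\ y = z /\ v = v1) \/
  (u1 = u /\ x = z /\ v1 = y :: v) \/
  (exists p, u = u1 ++ z :: p /\ v1 = p ++ x :: y :: v).
Proof.
  revert u1; induction u as [|a u IH]; intros u1 E.
  - destruct u1 as [|b [|b' u1]]; injection E as; subst; simpl; eauto 6.
  - destruct u1 as [|b u1]; injection E as -> E; [subst; simpl; eauto 6|].
    destruct (IH u1 E) as [(p & -> & ->)|[(-> & -> & ->)|[(-> & -> & ->)|(p & -> & ->)]]];
      simpl; eauto 8.
Qed.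

(* Cancelling an adjacent pair of stable letters reconnects the letters they were
   matched with; the isometry [F] transports the errors at no cost. *)
Lemma eval_cancel u x v g c : eval (u ++ x :: letter_inv x :: v) g c -> eval (u ++ v) g c.
Proof.
  intros Hw; remember (u ++ x :: letter_inv x :: v) as w eqn:Ew; revert u x v Ew.
  induction Hw as [g c Hc|h w g c Hw IH|s u1 a c1 v1 g c2 Hu1 IHu Ha Hv1 IHv]; intros u x v Ew.
  - now apply app_cons_not_nil in Ew.
  - destruct u as [|y u]; simpl in *; injection Ew as; subst.
    + simpl in Hw; apply eval_el_inv in Hw as (k & -> & Hk); now rewrite gmul_Vrk.
    + constructor; eauto.
  - destruct u as [|y u]; injection Ew as <- H; simpl in *.
    + destruct u1 as [|y p]; simpl in *.
      (* The pair is matched with itself around an empty block: [a] is within [c1] of [e], hence so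
         is [F s a]. *)
      * injection H as <-; inversion Hu1; subst.
        eapply eval_weaken; [exact Hv1|].
        destruct d_metric as (_ & _ & Hsym & _).
        rewrite <- (gmul_1l T g) at 1.
        rewrite tsi_right, Hsym, F_dist_one by auto; lra.
      (* The pair opens two nested blocks. Once it is removed, the inner closing letter is matched
         with the outer one. *)
      * injection H as -> <-.
        apply eval_st_inv in Hu1 as (p1 & q & b & k & c3 & c4 & -> & Hp1 & Hb & Hq & -> & ->).
        rewrite negb_involutive, <- app_assoc; simpl.
        assert (HFb : D s (F (negb s) b)) by auto using F_negb_maps.
        assert (Hk : D s k) by (eapply D_cancel_l; eauto).
        rewrite F_mul, F_negb_cancel by auto.
        rewrite <- gmul_assoc, Rplus_assoc; apply eval_app; auto; now constructor.
    + symmetry in H; apply app_pair_eq_app_cons in H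
        as [(p & -> & ->)|[(-> & Ex & ->)|[(-> & -> & ->)|(p & -> & ->)]]].
      * rewrite app_assoc; constructor; eauto.
      (* The pair closes two nested blocks, so the outer opening letter becomes matched with the
         inner one. *)
      * destruct x as [|s']; [discriminate|]; injection Ex as Ex.
        apply (f_equal negb) in Ex; rewrite !negb_involutive in Ex; subst s'.
        rewrite <- (negb_involutive s) in Hu1 at 1.
        apply eval_st_inv_last in Hu1
          as (p & q & k & b & c3 & c4 & -> & Hp & Hq & Hb & -> & <-).
        assert (HFb : D s (F (negb s) b)) by auto using F_negb_maps.
        assert (Hk : D s k) by (eapply D_cancel_r; eauto).
        rewrite F_mul, F_negb_cancel by auto.
        rewrite <- app_assoc, <- gmul_assoc, Rplus_assoc; simpl.
        constructor; auto; now apply eval_app.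
      (* The pair separates two consecutive blocks, which merge into one because [F s] is
         multiplicative. *)
      * simpl in Hv1; rewrite negb_involutive in Hv1.
        apply eval_st_inv in Hv1 as (p & q & b & k & c3 & c4 & -> & Hp & Hb & Hq & -> & ->).
        rewrite gmul_assoc, <- F_mul, <- Rplus_assoc, app_assoc by auto.
        constructor; auto; [now apply eval_app|auto using D_mul, D_inv].
      * rewrite <- app_assoc; simpl; constructor; eauto.
Qed.

(** Formal inversion sends a block [t u t^-1] to the block [t u^-1 t^-1] and reverses the order of
    the pieces. *)
Lemma eval_word_inv w g c : eval w g c -> eval (word_inv w) (g^-) c.
Proof.
  destruct d_metric as (Hpos & Hsep & Hsym & Htri).
  assert (Hnil : eval [] e 0) by (constructor; rewrite (proj2 (Hsep _ _) eq_refl); lra).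
  induction 1 as [g c Hc|h w g c Hw IH|s u a c1 v g c2 Hu IHu Ha Hv IHv].
  - constructor; rewrite <- (tsi_left T d g), gmul_Vr, gmul_1r, Hsym; auto.
  - rewrite ginv_mul, word_inv_cons, <- (Rplus_0_r c); apply eval_app; auto.
    rewrite <- (gmul_1r T (h^-)).
    now constructor.
  - rewrite ginv_mul.
    change (St s :: u ++ St (negb s) :: v) with ([St s] ++ u ++ [St (negb s)] ++ v).
    rewrite !word_inv_app, <- !app_assoc, Rplus_comm; apply eval_app; auto.
    replace ((F s a)^-) with (F s (a^-) ** e).
    2: { rewrite gmul_1r; apply ginv_unique.
         rewrite <- F_mul, gmul_Vr by (auto; auto using D_mul, D_inv); apply F_one. }
    simpl; rewrite negb_involutive, <- (Rplus_0_r c1); constructor; auto.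
    auto using D_mul, D_inv.
Qed.

(* The alternative [1 <= c] makes the cost finite on words such as the single letter [t],
   which evaluate to no group element. *)
Definition word_cost (w : list letter) (c : R) : Prop := 0 <= c /\ (eval w e c \/ 1 <= c).

Lemma word_cost_exists w : exists c, word_cost w c.
Proof. exists 1; split; [|right]; lra. Qed.

Lemma word_cost_nil : word_cost [] 0.
Proof.
  split; [lra|left; constructor].
  destruct d_metric as (_ & Hsep & _); rewrite (proj2 (Hsep _ _) eq_refl); lra.
Qed.

Lemma word_cost_app u v c c' : word_cost u c -> word_cost v c' -> word_cost (u ++ v) (c + c').
Proof.
  intros [Hc [Hu|Hu]] [Hc' [Hv|Hv]]; (split; [lra|]); try (right; lra).
  left; rewrite <- (gmul_1l T e); now apply eval_app.
Qed.

Lemma word_cost_word_inv w c : word_cost w c -> word_cost (word_inv w) c.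
Proof.
  intros [Hc [Hw|Hw]]; (split; [auto|]); [left|now right].
  rewrite <- (ginv_one T); now apply eval_word_inv.
Qed.

Lemma word_cost_cancel u x v c :
  word_cost (u ++ x ++ word_inv x ++ v) c -> word_cost (u ++ v) c.
Proof.
  revert u v; induction x as [|y x IH]; intros u v; auto.
  rewrite word_inv_cons, <- app_assoc; simpl.
  replace (u ++ y :: x ++ word_inv x ++ letter_inv y :: v)
    with ((u ++ [y]) ++ x ++ word_inv x ++ letter_inv y :: v) by now rewrite <- app_assoc.
  intros [Hc [Hw|Hw]]%IH; (split; [auto|]); [left|now right].
  rewrite <- app_assoc in Hw; now apply eval_cancel in Hw.
Qed.

(** Conjugate one letter at a time: a stable letter and its inverse form a block around a word of
    value [e], and [F s e = e]. *)
Lemma word_cost_conj x w c : word_cost w c -> word_cost (x ++ w ++ word_inv x) c.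
Proof.
  intros Hw; induction x as [|y x [Hc [Hx|Hx]]]; [simpl; now rewrite app_nil_r| |].
  - split; [auto|left]; rewrite word_inv_cons.
    replace ((y :: x) ++ w ++ word_inv x ++ [letter_inv y])
      with (y :: (x ++ w ++ word_inv x) ++ [letter_inv y]) by (simpl; now rewrite !app_assoc).
    destruct word_cost_nil as [_ [H0|H0]]; [|lra].
    destruct y as [h|s]; simpl.
    + rewrite <- (gmul_Vr T h); constructor.
      apply (eval_el (h^-)) in H0.
      pose proof (eval_app _ _ _ _ _ _ Hx H0) as Hc'.
      now rewrite gmul_1r, gmul_1l, Rplus_0_r in Hc'.
    + rewrite <- (gmul_1r T e), <- (F_one s) at 1.
      rewrite <- (Rplus_0_r c); constructor; auto using D_one.
  - split; [auto|now right].
Qed.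

Lemma word_cost_inv_l x : word_cost (word_inv x ++ x) 0.
Proof.
  rewrite <- (word_inv_involutive x) at 2.
  change (word_inv x ++ word_inv (word_inv x))
    with (word_inv x ++ [] ++ word_inv (word_inv x)).
  apply word_cost_conj, word_cost_nil.
Qed.

(** Prepend the free conjugate [u z u^-1] to [u v], then cancel [u^-1 u]. *)
Lemma word_cost_insert u z v c :
  word_cost z 0 -> word_cost (u ++ v) c -> word_cost (u ++ z ++ v) c.
Proof.
  intros Hz Huv; rewrite app_assoc.
  apply (word_cost_cancel _ (word_inv u)).
  rewrite word_inv_involutive.
  replace ((u ++ z) ++ word_inv u ++ u ++ v) with ((u ++ z ++ word_inv u) ++ u ++ v)
    by now rewrite <- !app_assoc.
  rewrite <- (Rplus_0_l c); apply word_cost_app; auto using word_cost_conj.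
Qed.

(** The last two clauses say that [dH] is the infimum of the costs of [word_inv u ++ v], without
    mentioning the norm itself. *)
Theorem exists_word_quotient :
  exists (H : Type) (TH : TopGroup H) (cl : list letter -> H) (dH : H -> H -> R),
    is_metric dH /\ compatible TH dH /\ two_sided_invariant TH dH /\
    (forall u v, cl (u ++ v) = gmul TH (cl u) (cl v)) /\
    (forall u, cl (word_inv u) = ginv TH (cl u)) /\
    (forall u v c, word_cost (word_inv u ++ v) c -> dH (cl u) (cl v) <= c) /\
    (forall u v r, dH (cl u) (cl v) < r -> exists c, word_cost (word_inv u ++ v) c /\ c < r).
Proof.
  destruct (exists_infimum_of_costs word_cost) as [N HN].
  { apply word_cost_exists. }
  { intros x c Hc; apply Hc. }
  assert (HN0 : forall w, word_cost w 0 -> N w = 0).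
  { intros w Hw; apply Rle_antisym; apply HN; auto. }
  destruct (exists_metric_quotient (@app letter) word_inv [] (fun u v => N (word_inv u ++ v)))
    as (H & TH & cl & dH & Hm & Hcomp & Htsi & HdH & Hmul & Hinv).
  - apply app_assoc.
  - reflexivity.
  - apply app_nil_r.
  - intros u v; apply HN.
  - intros u; apply HN0, word_cost_inv_l.
  - assert (Hsym : forall u v, N (word_inv u ++ v) <= N (word_inv v ++ u)).
    { intros u v; eapply infimum_of_costs_le; [exact HN|]; intros c Hc.
      apply word_cost_word_inv in Hc; now rewrite word_inv_app, word_inv_involutive in Hc. }
    intros u v; now apply Rle_antisym.
  - intros u v w; eapply infimum_of_costs_add; [exact HN|]; intros c c' Hc Hc'.
    (* The triangle inequality: concatenate [u^-1 v] with [v^-1 w] and cancel [v v^-1]. *)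
    apply (word_cost_cancel _ v); pose proof (word_cost_app _ _ _ _ Hc Hc') as Hcc.
    now rewrite <- app_assoc in Hcc.
  - intros g u v; eapply infimum_of_costs_le; [exact HN|]; intros c Hc.
    rewrite word_inv_app, <- app_assoc, (app_assoc _ g v).
    apply word_cost_insert; auto using word_cost_inv_l.
  - intros g u v; eapply infimum_of_costs_le; [exact HN|]; intros c Hc.
    rewrite word_inv_app.
    replace ((word_inv g ++ word_inv u) ++ v ++ g)
      with (word_inv g ++ (word_inv u ++ v) ++ word_inv (word_inv g))
      by now rewrite word_inv_involutive, <- !app_assoc.
    now apply word_cost_conj.
  - intros u; apply HN0; rewrite app_nil_r; apply word_cost_word_inv, word_cost_inv_l.
  - intros u; apply HN0; rewrite app_nil_r; apply word_cost_word_inv.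
    rewrite <- (word_inv_involutive u) at 1; apply word_cost_inv_l.
  - exists H, TH, cl, dH; split; [|split; [|split; [|split; [|split; [|split]]]]]; auto.
    + intros u v c Hc; rewrite HdH; now apply HN.
    + intros u v r; rewrite HdH; intros Hr.
      destruct (HN (word_inv u ++ v)) as (_ & _ & Hc).
      destruct (Hc (r - N (word_inv u ++ v))) as (c & Hwc & Hlt); [lra|].
      exists c; split; [auto|lra].
Qed.

Theorem exists_metric_HNN_extension : compatible T d ->
  exists (H : Type) (TH : TopGroup H) (j : G -> H) (t : H),
    metrizable TH /\ SIN_group TH /\ topgrp_embedding T TH j /\
    (forall a, D true a -> gmul TH (gmul TH t (j a)) (ginv TH t) = j (F true a)).
Proof.
  intros Hcomp.
  destruct exists_word_quotient
    as (H & TH & cl & dH & Hm & HcompH & Htsi & Hmul & Hinv & Hle & Hlt).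
  pose proof Hm as (HposH & HsepH & HsymH & HtriH).
  destruct d_metric as (Hpos & Hsep & Hsym & Htri).
  assert (Hnil : eval [] e 0) by (constructor; rewrite (proj2 (Hsep _ _) eq_refl); lra).
  assert (Hcl : forall u v, eval (word_inv u ++ v) e 0 -> cl u = cl v).
  { intros u v Huv; apply HsepH, Rle_antisym; auto; apply Hle; split; [lra|auto]. }
  assert (Hd : forall g h, dH (cl [El g]) (cl [El h]) <= d g h).
  { intros g h; apply Hle; split; [auto|left; simpl].
    apply (eval_weaken _ (g^- ** (h ** e)) _ 0); [now do 2 apply eval_el|].
    rewrite gmul_1r, <- (gmul_Vl T g), tsi_left, Hsym by auto; lra. }
  (* A radius at most [1] rules out the capped alternative. Without stable letters the only
     evaluation is direct multiplication, so its error bounds [d g h]. *)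
  assert (Hd' : forall g h r, r <= 1 -> dH (cl [El g]) (cl [El h]) < r -> d g h < r).
  { intros g h r Hr (c & [_ [Hc|Hc]] & Hcr)%Hlt; [|lra]; simpl in Hc.
    apply eval_el_inv in Hc as (k & Ek & Hc); apply eval_el_inv in Hc as (k' & -> & Hc).
    inversion Hc as [? ? Hk| |]; subst.
    apply Rle_lt_trans with c; auto.
    replace g with (h ** k'); [|now rewrite <- (gmul_Vrk T g (h ** k')), <- Ek, gmul_1r].
    rewrite <- (gmul_1r T h) at 2; now rewrite tsi_left. }
  exists H, TH, (fun g => cl [El g]), (cl [St true]); split; [|split; [|split]].
  - now exists dH.
  - now apply (SIN_of_tsi TH dH).
  - split; [|split; [|split]].
    + intros g h E; apply Hsep, Rle_antisym; auto.
      apply le_epsilon; intros r Hr.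
      assert (d g h < Rmin r 1); [|pose proof (Rmin_l r 1); lra].
      apply Hd'; [apply Rmin_r|].
      rewrite E, (proj2 (HsepH _ _) eq_refl); apply Rmin_glb_lt; lra.
    + intros g h; rewrite <- Hmul; apply Hcl; simpl.
      replace e with ((g ** h)^- ** (g ** (h ** e))); [now do 3 apply eval_el|].
      now rewrite gmul_1r, gmul_Vl.
    + intros W HW; apply Hcomp; intros x Hx.
      destruct (proj1 (HcompH W) HW _ Hx) as (r & Hr & HrW); exists r; split; auto.
      intros y Hy; apply HrW; specialize (Hd x y); lra.
    + intros U HU.
      (* A union of [dH]-balls centred in the image, each with a radius whose [d]-ball lies in [U];
         radii at most [1] make [Hd'] applicable. *)
      exists (fun h => exists x r, r <= 1 /\ (forall y, d x y < r -> U y) /\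
        dH (cl [El x]) h < r); split.
      * apply HcompH; intros h (x & r & Hr1 & HrU & Hh).
        exists (r - dH (cl [El x]) h); split; [lra|]; intros k Hk.
        exists x, r; repeat split; auto; specialize (HtriH (cl [El x]) h k); lra.
      * intros x; split.
        -- intros Ux; destruct (proj1 (Hcomp U) HU x Ux) as (r & Hr & HrU).
           exists x, (Rmin r 1); split; [apply Rmin_r|split].
           ++ intros y Hy; apply HrU; pose proof (Rmin_l r 1); lra.
           ++ rewrite (proj2 (HsepH _ _) eq_refl); apply Rmin_glb_lt; lra.
        -- intros (y & r & Hr1 & HrU & Hy); eauto.
  - intros a Ha; rewrite <- Hinv, <- !Hmul; apply Hcl; simpl.
    (* The inverse of [t a t^-1] is a single block around [a^-]; followed by the letter [F true a],
       it evaluates exactly to [e]. *)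
    replace e with (F true (a^- ** e) ** (F true a ** e)).
    + rewrite <- (Rplus_0_r 0); apply (eval_st true [El (a^-)]).
      * now apply eval_el.
      * rewrite gmul_1r; auto using D_inv.
      * now apply eval_el.
    + rewrite !gmul_1r, <- F_mul, gmul_Vl by auto using D_inv; apply F_one.
Qed.

End HNN.

(** * Restricting an invariant metric from [H], and extending [G] along [phi] *)

Theorem mainTheorem14 (G : Type) (TG : TopGroup G)
  (HmG : metrizable TG) (HsG : SIN_group TG)
  (A B : G -> Prop) (HA : closed_subgroup TG A) (HB : closed_subgroup TG B)
  (phi : G -> G) (Hphi : topgrp_iso_on TG A B phi) :
  (exists (H : Type) (TH : TopGroup H) (j : G -> H) (t : H),
     metrizable TH /\ SIN_group TH /\ topgrp_embedding TG TH j /\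
     (forall a, A a -> gmul TH (gmul TH t (j a)) (ginv TH t) = j (phi a)))
  <->
  (exists d : G -> G -> R, is_metric d /\ compatible TG d /\ two_sided_invariant TG d /\
     (forall a a', A a -> A a' -> d (phi a) (phi a') = d a a')).
Proof.
  split.
  - intros (H & TH & j & t & HmH & HsH & (j_inj & j_mul & j_cont & j_open) & Ht).
    destruct (SIN_metrizable_tsi TH HmH HsH) as (d & (Hpos & Hsep & Hsym & Htri) & Hc & Hi).
    exists (fun x y => d (j x) (j y)); split; [|split; [|split]].
    + repeat split; auto.
      * intros E; apply j_inj, Hsep, E.
      * intros ->; now apply Hsep.
    + intros U; split.
      * intros HU x Ux; destruct (j_open U HU) as (W & HW & HUW).
        destruct (proj1 (Hc W) HW (j x)) as (r & Hr & HrW); [now apply HUW|].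
        exists r; split; auto; intros y Hy; now apply HUW, HrW.
      (* Preimages of [d]-balls are open in [G], but openness of [U] is a pointwise matter; a
         compatible metric [delta] on [G] provides the pointwise test. *)
      * intros HU; destruct HmG as (delta & _ & Hdelta).
        apply Hdelta; intros x Ux; destruct (HU x Ux) as (r & Hr & HrU).
        assert (Hball : gopen TH (fun h => d (j x) h < r)).
        { apply Hc; intros h Hh; exists (r - d (j x) h); split; [lra|].
          intros k Hk; specialize (Htri (j x) h k); lra. }
        apply j_cont in Hball.
        destruct (proj1 (Hdelta _) Hball x) as (s & Hs & HsU).
        { now rewrite (proj2 (Hsep _ _) eq_refl). }
        exists s; split; auto.
    + intros g x y; rewrite !j_mul; apply Hi.
    (* Both values of [phi] are conjugates by [t], and the translations by [t] and its inverse
       preserve [d]. *)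
    + intros a a' Ha Ha'; rewrite <- !Ht, tsi_right, tsi_left; auto.
  - intros (d & Hm & Hc & Hi & Hiso).
    destruct Hphi as (phi_maps & phi_onto & phi_inj & phi_mul & _ & _).
    (* A total inverse of [phi] by choice; outside [B] the requirement is vacuous and [b] itself
       serves as witness. *)
    assert (Hpsi : exists psi, forall b, B b -> A (psi b) /\ phi (psi b) = b).
    { apply (functional_choice (fun b a => B b -> A a /\ phi a = b)); intros b.
      destruct (Classical_Prop.classic (B b)) as [Hb|]; [|exists b; tauto].
      destruct (phi_onto b Hb) as (a & Ha & E); eauto. }
    destruct Hpsi as [psi Hpsi].
    assert (psi_phi : forall a, A a -> psi (phi a) = a).
    { intros a Ha; apply phi_inj; auto; apply Hpsi; auto. }
    destruct HA as [HA _], HB as [HB _].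
    apply (exists_metric_HNN_extension TG d Hm Hi
      (fun s : bool => if s then A else B) (fun s : bool => if s then phi else psi)); auto.
    + now intros [].
    + intros []; simpl; auto; intros b Hb; now apply Hpsi.
    + intros []; auto; intros b b' Hb Hb'.
      destruct (Hpsi b Hb) as [Ha E], (Hpsi b' Hb') as [Ha' E'].
      rewrite <- E, <- E' at 1; rewrite <- phi_mul by auto.
      apply psi_phi; now apply HA.
    + intros []; simpl; auto; intros b Hb; now apply Hpsi.
    + intros []; auto; intros b b' Hb Hb'.
      destruct (Hpsi b Hb) as [Ha E], (Hpsi b' Hb') as [Ha' E'].
      now rewrite <- E, <- E' at 2; rewrite Hiso.
Qed.
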